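(* Consider a multilayer network with $M$ layers, where layer $h\in\{1,\dots,M\}$ has $N_h$ nodes, node set $V=\{(i,h): h=1,\dots,M,\ i=1,\dots,N_h\}$, and nonnegative weights $w_{ij}(hk)$ between node $i$ of layer $h$ and node $j$ of layer $k$; assume the network is weighted, undirected and connected, so that the multilayer Laplacian $\mathcal{L}$ (defined in the context) is symmetric. Let $f_{ih}:\mathbb{R}\to\mathbb{R}$, $(i,h)\in V$, and suppose $\tilde f(Y)=\sum_{(i,h)\in V} f_{ih}(y_{ih})$, $Y=(y_{ih})\in\mathbb{R}^V$, is a twice continuously differentiable convex function. Consider the saddle-point dynamics $$\dot Y(t)=-\nabla\tilde f(Y(t))-\mathcal{L}Y(t)-\mathcal{L}\Lambda(t),\qquad \dot\Lambda(t)=\mathcal{L}Y(t),$$ with $Y(t),\Lambda(t)\in\mathbb{R}^V$, which is the saddle-point flow of the augmented Lagrangian $\mathcal{L}_m(Y,\Lambda)=\tilde f(Y)+\langle\Lambda,\mathcal{L}Y\rangle+\tfrac12\langle Y,\mathcal{L}Y\rangle$. Then every trajectory $(Y(t),\Lambda(t))$ converges to a unique saddle point $(Y^\star,\Lambda^\star)$ of $\mathcal{L}_m$, characterized by: (1) $Y^\star=x^\star U$, where $x^\star\in\mathbb{R}$ is an optimizer of the primal problem $\min_{x\in\mathbb{R}}\sum_{(i,h)\in V}f_{ih}(x)$; (2) $\Lambda^\star=\bar\Lambda+\operatorname{average}(\Lambda_0)\,U$, where $\operatorname{average}(\Lambda_0)=\frac{1}{|V|}\sum_{(i,h)\in V}\Lambda_{ih}(0)$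 and $\bar\Lambda\in\mathbb{R}^V$ with $\bar\Lambda\perp U$ satisfies $\mathcal{L}\bar\Lambda+\nabla\tilde f(Y^\star)=0$.
   Context: $U\in\mathbb{R}^V$ is the all-ones tensor. For $T\in\mathbb{R}^V$, $(\mathcal{L}T)_{ih}=\sum_{k=1}^M\sum_{j=1}^{N_k} l_{ij}(hk)\,t_{jk}$, where $l_{ij}(hk)=\Big[\sum_{n=1}^M\sum_{m=1}^{N_n} w_{mi}(nh)\Big]\delta_{ij}\delta_{hk}-w_{ij}(hk)$ (the multilayer combinatorial Laplacian tensor; $\delta$ is the Kronecker delta). Undirected means $w_{ij}(hk)=w_{ji}(kh)$; connected means the graph on $V$ with an edge between $(i,h)$ and $(j,k)$ whenever $w_{ij}(hk)>0$ is connected. $\langle A,B\rangle=\sum_{(i,h)\in V}a_{ih}b_{ih}$, and $\bar\Lambda\perp U$ means $\langle\bar\Lambda,U\rangle=0$. $\nabla\tilde f(Y)$ has components $f_{ih}'(y_{ih})$. A saddle point of $\mathcal{L}_m$ is a solution of $\min_Y\max_\Lambda\mathcal{L}_m(Y,\Lambda)$.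
   Formalization: The formal theorem assumes that the primal problem has an optimizer; without this the claim fails (one node, f(x)=x gives Y(t) → −∞). ''Unique'' is read as the limit of each trajectory, since saddle points need not be unique (f=0). *)

(* Defs.v *)
From HB Require Import structures.
From mathcomp Require Import all_boot all_order all_algebra.
From mathcomp Require Import all_classical all_reals all_analysis.
Set Implicit Arguments. Unset Strict Implicit. Unset Printing Implicit Defensive.
Import Order.TTheory GRing.Theory Num.Theory.
Import numFieldNormedType.Exports.
Local Open Scope ring_scope.

Definition node (M : nat) (N : 'I_M -> nat) : finType := {h : 'I_M & 'I_(N h)}.

Section Defs.
Variables (R : realType) (V : finType).

(* multilayer combinatorial Laplacian tensor entry l_{ij}(hk), with v=(i,h), u=(j,k):
   [sum_{(m,n)} w_{mi}(nh)] delta_{ij} delta_{hk} - w_{ij}(hk) *)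
Definition lap_entry (w : V -> V -> R) (v u : V) : R :=
  (if v == u then \sum_(m : V) w m v else 0) - w v u.

Definition lap (w : V -> V -> R) (T : V -> R) : V -> R :=
  fun v => \sum_(u : V) lap_entry w v u * T u.

Definition inner (A B : V -> R) : R := \sum_(v : V) A v * B v.

Definition ones : V -> R := fun _ => 1.

Definition undirected (w : V -> V -> R) : Prop := forall v u, w v u = w u v.

Definition nonneg_weights (w : V -> V -> R) : Prop := forall v u, 0 <= w v u.

Definition connected_net (w : V -> V -> R) : Prop :=
  forall v u, connect [rel a b | 0 < w a b] v u.

Definition ftilde (f : V -> R -> R) (Y : V -> R) : R := \sum_(v : V) f v (Y v).

Definition grad_ftilde (f : V -> R -> R) (Y : V -> R) : V -> R :=
  fun v => derive1 (f v) (Y v).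

Definition convex_fun (F : (V -> R) -> R) : Prop :=
  forall (Y Z : V -> R) (t : R), 0 <= t <= 1 ->
    F (fun v => (1 - t) * Y v + t * Z v) <= (1 - t) * F Y + t * F Z.

Definition C2 (g : R -> R) : Prop :=
  (forall x, derivable g x 1) /\ (forall x, derivable (derive1 g) x 1) /\
  continuous (derive1 (derive1 g)).

Definition Lm (w : V -> V -> R) (f : V -> R -> R) (Y Lam : V -> R) : R :=
  ftilde f Y + inner Lam (lap w Y) + 2^-1 * inner Y (lap w Y).

Definition saddle_point (w : V -> V -> R) (f : V -> R -> R) (Ys Ls : V -> R) : Prop :=
  forall Y Lam, Lm w f Ys Lam <= Lm w f Ys Ls /\ Lm w f Ys Ls <= Lm w f Y Ls.

Definition average (A : V -> R) : R := (#|V|%:R)^-1 * \sum_(v : V) A v.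

End Defs.

(* Main.v *)
(* With (Ys, Ls) an equilibrium, E = (|Y - Ys|^2 + |Lam - Ls|^2) / 2 satisfies
   E' = - D, where D = <Y - Ys, grad Y - grad Ys> + <Y, L Y> >= 0.  So the
   trajectory is bounded, and Barbalat's lemma gives D -> 0; hence L Y -> 0, and
   a second use of Barbalat's lemma gives L Y' -> 0.  Take limits of all
   coordinates along an ultrafilter finer than t -> +oo: D = 0 and L Y' = 0 there
   force Y to be constant with grad Y = grad Ys, and Y' to be a constant vector
   of zero sum.  So the limit point is itself an equilibrium, and the energy
   relative to it is nonincreasing and tends to 0 along the ultrafilter, hence
   tends to 0.  This replaces LaSalle's invariance principle, and with it
   existence and uniqueness for the flow. *)
Require Import Defs.
From HB Require Import structures.
From mathcomp Require Import all_boot all_order all_algebra.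
From mathcomp Require Import all_classical all_reals all_analysis.
From mathcomp Require Import ring lra.
Import Order.TTheory GRing.Theory Num.Theory.
Import numFieldNormedType.Exports.
Local Open Scope classical_set_scope.
Local Open Scope ring_scope.

Section Laplacian.
Context {R : realType} {V : finType} (w : V -> V -> R).
Hypothesis Hund : undirected w.
Implicit Types A B T : V -> R.

Lemma lapE T v : lap w T v = \sum_u w v u * (T v - T u).
Proof.
rewrite /lap /lap_entry.
under eq_bigr do rewrite mulrBl.
under [RHS]eq_bigr do rewrite mulrBr.
rewrite !sumrB; congr (_ - _).
rewrite (bigD1 v) //= eqxx [X in _ + X]big1 ?addr0; last first.
  by move=> u /negbTE uv; rewrite eq_sym uv mul0r.
by rewrite mulr_suml; apply: eq_bigr => u _; rewrite Hund.
Qed.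

Lemma lapB A B v : lap w (fun u => A u - B u) v = lap w A v - lap w B v.
Proof. by rewrite /lap -sumrB; apply: eq_bigr => u _; rewrite mulrBr. Qed.

Lemma lap_cst c v : lap w (fun=> c) v = 0.
Proof. by rewrite lapE big1 // => u _; rewrite subrr mulr0. Qed.

Lemma inner_lap A B :
  inner A (lap w B) = 2^-1 * \sum_v \sum_u w v u * ((A v - A u) * (B v - B u)).
Proof.
have H : inner A (lap w B) = \sum_v \sum_u w v u * (A v * (B v - B u)).
  apply: eq_bigr => v _; rewrite lapE mulr_sumr.
  by apply: eq_bigr => u _; rewrite mulrCA.
have H' : inner A (lap w B) = \sum_v \sum_u w v u * (A u * (B u - B v)).
  rewrite H exchange_big; apply: eq_bigr => v _; apply: eq_bigr => u _.
  by rewrite Hund.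
have -> : \sum_v \sum_u w v u * ((A v - A u) * (B v - B u)) =
    inner A (lap w B) + inner A (lap w B).
  rewrite {1}H H' -big_split; apply: eq_bigr => v _; rewrite -big_split.
  by apply: eq_bigr => u _ /=; ring.
by field.
Qed.

Lemma inner_lapC A B : inner A (lap w B) = inner B (lap w A).
Proof.
rewrite !inner_lap; congr (_ * _).
by apply: eq_bigr => v _; apply: eq_bigr => u _; rewrite (mulrC (A v - _)).
Qed.

Lemma sum_lap T : \sum_v lap w T v = 0.
Proof.
have -> : \sum_v lap w T v = inner (fun=> 1) (lap w T).
  by apply: eq_bigr => v _; rewrite mul1r.
by rewrite inner_lapC /inner big1 // => v _; rewrite lap_cst mulr0.
Qed.

Hypothesis Hnn : nonneg_weights w.

Lemma edge_le_inner_lap T v u :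
  w v u * (T v - T u) ^+ 2 <= 2 * inner T (lap w T).
Proof.
rewrite inner_lap mulVKf ?pnatr_eq0 //.
have h0 a b : 0 <= w a b * ((T a - T b) * (T a - T b)).
  by rewrite mulr_ge0 // -expr2 sqr_ge0.
rewrite (bigD1 v) //= (bigD1 u) //= -expr2 -addrA lerDl addr_ge0 //.
  by apply: sumr_ge0 => *.
by apply: sumr_ge0 => *; apply: sumr_ge0 => *.
Qed.

Lemma inner_lap_ge0 T : 0 <= inner T (lap w T).
Proof.
rewrite inner_lap mulr_ge0 ?invr_ge0 // sumr_ge0 // => a _.
by rewrite sumr_ge0 // => b _; rewrite mulr_ge0 // -expr2 sqr_ge0.
Qed.

Hypothesis Hconn : connected_net w.

Lemma inner_lap_eq0 T : inner T (lap w T) = 0 -> forall v u, T v = T u.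
Proof.
move=> T0 v u; have /connectP [p] := Hconn v u.
elim: p v => [|a p IH] v /=; first by move=> _ ->.
move=> /andP[wva pa] ua; rewrite -(IH a pa ua).
have := edge_le_inner_lap T v a; rewrite T0 mulr0 pmulr_rle0 // => h.
have : (T v - T a) ^+ 2 = 0 by apply/eqP; rewrite eq_le h sqr_ge0.
by move=> /eqP; rewrite sqrf_eq0 subr_eq0 => /eqP.
Qed.

(* [L + J], with [J] the all-ones matrix, is injective: pairing [(L + J) T = 0]
   with [T] kills both nonnegative terms. *)
Lemma lap_solve (b : V -> R) : \sum_v b v = 0 ->
  exists T : V -> R, forall v, lap w T v = b v.
Proof.
move=> b0; pose n := #|V|.
pose K : 'M[R]_n := \matrix_(i, j) (lap_entry w (enum_val j) (enum_val i) + 1).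
have KE (x : 'rV[R]_n) j : (x *m K) 0 j =
    lap w (fun v => x 0 (enum_rank v)) (enum_val j) + \sum_v x 0 (enum_rank v).
  rewrite mxE /lap -big_split /=.
  rewrite (reindex (@enum_rank V)) /=; last first.
    by apply: onW_bij; exists enum_val; [exact: enum_rankK | exact: enum_valK].
  by apply: eq_bigr => v _; rewrite mxE enum_rankK; ring.
have Kfree : row_free K.
  apply: inj_row_free => x xK; pose T v := x 0 (enum_rank v).
  have LJ v : lap w T v + \sum_u T u = 0.
    by have := KE x (enum_rank v); rewrite xK mxE enum_rankK.
  have TT : inner T (lap w T) + (\sum_u T u) ^+ 2 = 0.
    rewrite expr2 mulr_suml /inner -big_split big1 //= => v _.
    by rewrite -mulrDr LJ mulr0.
  have := inner_lap_ge0 T; have := sqr_ge0 (\sum_u T u) => S0 Q0.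
  have /inner_lap_eq0 Tc : inner T (lap w T) = 0 by lra.
  have /eqP : (\sum_u T u) ^+ 2 = 0 by lra.
  rewrite sqrf_eq0 => /eqP s0.
  apply/rowP => j; rewrite mxE -(enum_valK j) -/(T (enum_val j)).
  have : \sum_u T u = n%:R * T (enum_val j).
    rewrite (eq_bigr (fun=> T (enum_val j))) // sumr_const [RHS]mulr_natl.
    by [].
  rewrite s0 => /esym/eqP; rewrite mulf_eq0 => /orP[|/eqP //].
  by rewrite pnatr_eq0 => /eqP n0; have := fintype0 (enum_val j) n0.
have Ku : K \in unitmx by rewrite -row_free_unit.
pose x := (\row_j b (enum_val j)) *m invmx K.
have xE v : lap w (fun v => x 0 (enum_rank v)) v + \sum_u x 0 (enum_rank u) = b v.
  by have := KE x (enum_rank v); rewrite mulmxKV // mxE enum_rankK.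
exists (fun v => x 0 (enum_rank v)) => v; rewrite -(xE v).
suff -> : \sum_u x 0 (enum_rank u) = 0 by rewrite addr0.
have := b0; under eq_bigr do rewrite -xE.
rewrite big_split /= sum_lap add0r sumr_const -mulr_natl => /eqP.
rewrite mulf_eq0 => /orP[|/eqP //].
rewrite pnatr_eq0 => /eqP n0.
by rewrite big1 // => u _; have := fintype0 u n0.
Qed.

End Laplacian.

Section Convex.
Context {R : realType}.

Lemma convex_component (V : finType) (f : V -> R -> R) :
  convex_fun (ftilde f) -> forall v (a b t : R), 0 <= t <= 1 ->
  f v ((1 - t) * a + t * b) <= (1 - t) * f v a + t * f v b.
Proof.
move=> cf v a b t t01.
pose S x u := if u == v then x else 0 : R.
have := cf (S a) (S b) t t01; rewrite /ftilde.
rewrite (bigD1 v) //= [X in _ <= (1 - t) * X + _](bigD1 v) //=.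
rewrite [X in _ <= _ + t * X](bigD1 v) //= /S !eqxx.
set s1 := \sum_(_ | _) _; set s2 := \sum_(_ | _) _; set s3 := \sum_(_ | _) _.
have -> : s1 = s3 by apply: eq_bigr => u /negbTE ->; rewrite !mulr0 addr0.
have -> : s2 = s3 by apply: eq_bigr => u /negbTE ->.
lra.
Qed.

Lemma convex_tangent (g : R -> R) :
  (forall a b t, 0 <= t <= 1 ->
     g ((1 - t) * a + t * b) <= (1 - t) * g a + t * g b) ->
  (forall x, derivable g x 1) ->
  forall x y, g x + derive1 g x * (y - x) <= g y.
Proof.
move=> cg dg x y.
pose h (t : R) := g (x + t * (y - x)).
have dh : is_derive (0 : R) (1 : R) h (derive1 g x * (y - x)).
  have d1 : is_derive (0 : R) (1 : R) (fun t => x + t * (y - x)) (y - x).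
    have := is_deriveD (is_derive_cst x (0 : R) (1 : R))
      (is_deriveZ (y - x) (is_derive_id (0 : R) (1 : R))).
    rewrite add0r [_ *: _]mulr1; congr (is_derive _ _ _ _).
    by apply/funext => t; rewrite /= mulrC.
  have d2 : is_derive (x + 0 * (y - x)) (1 : R) g (derive1 g x).
    by rewrite mul0r addr0 derive1E; apply: derivableP.
  have := @is_derive1_comp R g _ 0 _ _ d2 d1.
  by rewrite /h mulrC.
have [dh0 dhE] := dh.
have /cvg_dnbhs_at_right cvq : k^-1 *: (h (k *: 1 + 0) - h 0) @[k --> 0^'] -->
  'D_1 h 0 by exact: dh0.
rewrite -lerBrDl -dhE; apply: (cvgr_to_le cvq); near=> k.
have k0 : 0 < k by near: k; exact: nbhs_right_gt.
have k1 : k <= 1 by near: k; exact: nbhs_right_le.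
rewrite /h addr0 mul0r addr0 [k *: _]mulr1 /= -[_ *: _]/(_ * _).
rewrite ler_pdivrMl //.
have := cg x y k; rewrite (ltW k0) k1 => /(_ isT).
rewrite (_ : (1 - k) * x + k * y = x + k * (y - x)); last by ring.
lra.
Unshelve. all: by end_near. Qed.

Lemma convex_derive1_monotone (g : R -> R) :
  (forall x y, g x + derive1 g x * (y - x) <= g y) ->
  forall x y, 0 <= (y - x) * (derive1 g y - derive1 g x).
Proof. by move=> tg x y; have := tg x y; have := tg y x; lra. Qed.

End Convex.

Lemma ultra_fmap {S T : Type} (u : S -> T) (F : set_system S) :
  UltraFilter F -> UltraFilter (u @ F).
Proof.
move=> FU; split; first exact: fmap_proper_filter.
move=> G GF uFG; rewrite eqEsubset; split=> // A GA.
have [//|FnA] := in_ultra_setVsetC (u @^-1` A) FU.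
have GnA : G (~` A) by exact: uFG.
by have [x []] := filter_ex (filterI GA GnA).
Qed.

Lemma ultra_bounded_cvg {R : realType} {S : Type} (F : set_system S)
    (FU : UltraFilter F) (u : S -> R) (K : R) :
  F [set s | `|u s| <= K] -> exists l : R, u @ F --> l.
Proof.
move=> uK; have FuU := ultra_fmap u F FU.
have := @segment_compact R (- K) K; rewrite compact_ultra => /(_ _ FuU).
case=> [|l [_ ul]]; last by exists l.
by apply: (@filterS _ F _ _ _ _ uK) => s us; rewrite /= in_itv /= -ler_norml.
Qed.

Section RealLine.
Context {R : realType}.
Implicit Types (u du g : R -> R) (K l c s t : R).

Lemma nonincreasing_cvg_pinfty u :
  (forall s t, 0 < s -> s <= t -> u t <= u s) -> (forall t, 0 <= u t) ->
  exists l : R, u @ +oo --> l.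
Proof.
move=> uni u0; pose v t := - u (Num.max t 1).
have m0 t : 0 < Num.max t 1 :> R by rewrite lt_max ltr01 orbT.
have vnd : nondecreasing_fun v.
  move=> s t st; rewrite lerN2; apply: uni => //.
  by rewrite ge_max !le_max st lexx orbT.
have vub : has_ubound (range v).
  by exists 0 => _ [t _ <-]; rewrite oppr_le0.
exists (- sup (range v)); have /cvgN := nondecreasing_cvgr vnd vub.
apply: cvg_trans; apply: near_eq_cvg; near=> t.
rewrite fctE opprK max_l //; near: t; exact: nbhs_pinfty_ge.
Unshelve. all: by end_near. Qed.

Lemma derive_bound_dist u du K s t : s <= t ->
  (forall x, s <= x <= t -> is_derive x (1 : R) u (du x)) ->
  (forall x, s <= x <= t -> `|du x| <= K) ->
  `|u t - u s| <= K * (t - s).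
Proof.
move=> st udu duK.
have [||x xst ->] := @MVT_segment R u du s t st.
- by move=> x; rewrite in_itv /= => /andP[sx xt]; apply: udu; rewrite !ltW.
- apply: derivable_within_continuous => x; rewrite in_itv /= => xst.
  by have [] := udu x xst.
rewrite normrM (ger0_norm (x := t - s)) ?subr_ge0 //.
by rewrite ler_wpM2r ?subr_ge0 // duK //; move: xst; rewrite in_itv.
Qed.

Lemma derive_bound_distC u du K s t :
  (forall x, Num.min s t <= x <= Num.max s t ->
     is_derive x (1 : R) u (du x)) ->
  (forall x, Num.min s t <= x <= Num.max s t -> `|du x| <= K) ->
  `|u s - u t| <= K * `|s - t|.
Proof.
wlog st : s t / s <= t => [hw udu duK|].
  have [/hw|/ltW /hw] := leP s t; first exact.
  by rewrite minC maxC distrC [X in _ * X]distrC; apply.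
rewrite min_l // max_r // distrC [X in _ * X]distrC (ger0_norm (x := t - s)) ?subr_ge0 //.
exact: (derive_bound_dist _ du).
Qed.

Lemma barbalat u du K l :
  (forall t, 0 < t -> is_derive t (1 : R) u (du t)) ->
  (forall s t, 0 < s -> 0 < t -> `|du s - du t| <= K * `|s - t|) ->
  u @ +oo --> l -> du @ +oo --> 0.
Proof.
move=> udu duK ul; apply/cvgrPdist_le => e e0.
pose C := `|K| + 1; have C0 : 0 < C by rewrite /C; have := normr_ge0 K; lra.
pose d := e / (2 * C); have d0 : 0 < d by rewrite divr_gt0 // mulr_gt0.
have Cd : C * d = e / 2 by rewrite /d; field; rewrite gt_eqF.
have eta0 : 0 < e * d / 4 by rewrite divr_gt0 // mulr_gt0.
move/cvgrPdist_le: ul => /(_ _ eta0) [N [_ ul]].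
exists (Num.max N 0); split; first exact: num_real.
move=> t /=; rewrite gt_max => /andP[Nt t0]; rewrite sub0r normrN.
have td : t < t + d by rewrite ltrDl.
have [||x] := @MVT R u du t (t + d) td.
- by move=> x; rewrite in_itv /= => /andP[tx _]; exact/udu/(lt_trans t0).
- apply: derivable_within_continuous => x; rewrite in_itv /= => /andP[tx _].
  by have [] := udu x (lt_le_trans t0 tx).
rewrite in_itv /= addrAC subrr add0r => /andP[tx xd] eq_u.
have x0 := lt_trans t0 tx.
have h1 : `|du x| * d <= e * d / 2.
  rewrite -[X in _ * X <= _]gtr0_norm // -normrM -eq_u.
  have := ul _ Nt; have := ul _ (lt_trans Nt td).
  rewrite !ler_norml; lra.
have {}h1 : `|du x| <= e / 2 by rewrite -(ler_pM2r d0) mulrAC.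
have h2 : `|du t - du x| <= e / 2.
  rewrite -Cd; apply: le_trans (duK _ _ t0 x0) _.
  apply: (@le_trans _ _ (C * `|t - x|)).
    by rewrite ler_wpM2r // /C; have := ler_norm K; lra.
  by rewrite ler_pM2l // distrC ger0_norm; lra.
have := ler_normD (du t - du x) (du x); rewrite subrK; lra.
Qed.

Definition bounded_pos u := exists K, forall t, 0 < t -> `|u t| <= K.

Lemma bounded_posD u v : bounded_pos u -> bounded_pos v ->
  bounded_pos (fun t => u t + v t).
Proof.
move=> [K uK] [L vL]; exists (K + L) => t t0.
by apply: le_trans (ler_normD _ _) _; rewrite lerD ?uK ?vL.
Qed.

Lemma bounded_posZ c u : bounded_pos u -> bounded_pos (fun t => c * u t).
Proof.
by move=> [K uK]; exists (`|c| * K) => t t0; rewrite normrM ler_wpM2l ?uK.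
Qed.

Lemma bounded_posN u : bounded_pos u -> bounded_pos (fun t => - u t).
Proof. by move=> [K uK]; exists K => t t0; rewrite normrN uK. Qed.

Lemma bounded_pos_sum (V : finType) (u : V -> R -> R) :
  (forall v, bounded_pos (u v)) -> bounded_pos (fun t => \sum_v u v t).
Proof.
move=> uB; elim: (index_enum V) => [|v r IH].
  by exists 0 => t _; rewrite big_nil normr0.
by under eq_fun do rewrite big_cons; exact: bounded_posD.
Qed.

Lemma continuous_bounded_segment g K : continuous g ->
  exists L, forall x, `|x| <= K -> `|g x| <= L.
Proof.
move=> cg; have [K0|K0] := leP 0 K; last first.
  by exists 0 => x xK; have := normr_ge0 x; lra.
have [||c _ cmax] := @EVT_max R (fun x => `|g x|) (- K) K.
- by rewrite lerNl; lra.
- apply: continuous_subspaceT => x; apply: continuous_comp; first exact: cg.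
  exact: norm_continuous.
by exists `|g c| => x xK; apply: cmax; rewrite in_itv /= -ler_norml.
Qed.

Lemma bounded_pos_comp g u : continuous g -> bounded_pos u ->
  bounded_pos (fun t => g (u t)).
Proof.
move=> cg [K uK]; have [L gL] := continuous_bounded_segment g K cg.
by exists L => t t0; exact/gL/uK.
Qed.

Definition bounded_lipschitz u := exists2 K : R, 0 <= K &
  (forall t, 0 < t -> `|u t| <= K) /\
  (forall s t, 0 < s -> 0 < t -> `|u s - u t| <= K * `|s - t|).

Lemma bounded_lipschitz_cst c : bounded_lipschitz (fun=> c).
Proof.
exists `|c| => //; split=> // s t _ _.
by rewrite subrr normr0 mulr_ge0.
Qed.

Lemma bounded_lipschitzD u v : bounded_lipschitz u -> bounded_lipschitz v ->
  bounded_lipschitz (fun t => u t + v t).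
Proof.
move=> [K K0 [uK Ku]] [L L0 [vL Lv]]; exists (K + L); first exact: addr_ge0.
split=> [t t0|s t s0 t0].
  by apply: le_trans (ler_normD _ _) _; rewrite lerD ?uK ?vL.
rewrite opprD addrACA mulrDl; apply: le_trans (ler_normD _ _) _.
by rewrite lerD ?Ku ?Lv.
Qed.

Lemma bounded_lipschitzM u v : bounded_lipschitz u -> bounded_lipschitz v ->
  bounded_lipschitz (fun t => u t * v t).
Proof.
move=> [K K0 [uK Ku]] [L L0 [vL Lv]].
exists (K * L + 2 * (K * L)); first by rewrite addr_ge0 // !mulr_ge0.
have KL : 0 <= K * L by rewrite mulr_ge0.
split=> [t t0|s t s0 t0].
  apply: (@le_trans _ _ (K * L)); last by rewrite lerDl mulr_ge0.
  by rewrite normrM ler_pM ?uK ?vL.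
rewrite (_ : _ - _ = (u s - u t) * v s + u t * (v s - v t)); last by ring.
apply: le_trans (ler_normD _ _) _; rewrite !normrM.
have h1 : `|u s - u t| * `|v s| <= K * `|s - t| * L by rewrite ler_pM ?Ku ?vL.
have h2 : `|u t| * `|v s - v t| <= K * (L * `|s - t|) by rewrite ler_pM ?uK ?Lv.
have := mulr_ge0 KL (normr_ge0 (s - t)); lra.
Qed.

Lemma bounded_lipschitzN u : bounded_lipschitz u ->
  bounded_lipschitz (fun t => - u t).
Proof.
move=> [K K0 [uK Ku]]; exists K => //; split=> [t t0|s t s0 t0].
  by rewrite normrN uK.
by rewrite -opprD normrN Ku.
Qed.

Lemma bounded_lipschitz_sum (V : finType) (u : V -> R -> R) :
  (forall v, bounded_lipschitz (u v)) ->
  bounded_lipschitz (fun t => \sum_v u v t).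
Proof.
move=> uBL; elim: (index_enum V) => [|v r IH].
  by under eq_fun do rewrite big_nil; exact: bounded_lipschitz_cst.
by under eq_fun do rewrite big_cons; exact: bounded_lipschitzD.
Qed.

Lemma bounded_lipschitz_derive u du : bounded_pos u -> bounded_pos du ->
  (forall t, 0 < t -> is_derive t (1 : R) u (du t)) ->
  bounded_lipschitz u.
Proof.
move=> [K uK] [L duL] udu.
exists (`|K| + `|L|); first exact: addr_ge0; split=> [t t0|s t s0 t0].
  have := uK t t0; have := ler_norm K; have := normr_ge0 L; lra.
apply: (@le_trans _ _ (L * `|s - t|)).
  have m0 x : Num.min s t <= x <= Num.max s t -> 0 < x.
    by move=> /andP[+ _]; apply: lt_le_trans; rewrite lt_min s0.
  by apply: (@derive_bound_distC _ du) => x /m0 x0; [exact: udu | exact: duL].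
by rewrite ler_wpM2r //; have := ler_norm L; have := normr_ge0 K; lra.
Qed.

Lemma bounded_lipschitz_comp g u : (forall x, derivable g x 1) ->
  continuous (derive1 g) -> bounded_lipschitz u ->
  bounded_lipschitz (fun t => g (u t)).
Proof.
move=> dg cdg [K K0 [uK Ku]].
have cg : continuous g.
  by move=> x; apply/differentiable_continuous/derivable1_diffP/dg.
have [B gB] := continuous_bounded_segment g K cg.
have [L dgL] := continuous_bounded_segment (derive1 g) K cdg.
have gL a b : `|a| <= K -> `|b| <= K -> `|g a - g b| <= L * `|a - b|.
  move=> /ler_normlP[a1 a2] /ler_normlP[b1 b2].
  apply: (@derive_bound_distC _ (derive1 g)) => x /andP[x1 x2].
    by rewrite derive1E; exact: derivableP.
  apply: dgL; rewrite ler_norml; move: x1 x2; rewrite ge_min le_max.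
  by move=> /orP[] h /orP[] h'; apply/andP; split; lra.
exists (`|B| + `|L| * K); first by rewrite addr_ge0 ?mulr_ge0.
have LK : 0 <= `|L| * K by exact: mulr_ge0.
split=> [t t0|s t s0 t0].
  by have := gB _ (uK t t0); have := ler_norm B; lra.
apply: le_trans (gL _ _ (uK s s0) (uK t t0)) _.
apply: (@le_trans _ _ (`|L| * (K * `|s - t|))); last first.
  by rewrite mulrA ler_wpM2r // lerDr.
apply: (@le_trans _ _ (`|L| * `|u s - u t|)).
  by rewrite ler_wpM2r ?ler_norm.
by rewrite ler_wpM2l ?Ku.
Qed.

Lemma is_derive_fsum (V : finType) (u : V -> R -> R) (du : V -> R) (t : R) :
  (forall v, is_derive t (1 : R) (u v) (du v)) ->
  is_derive t (1 : R) (fun s => \sum_v u v s) (\sum_v du v).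
Proof.
move=> udu; elim: (index_enum V) => [|v r IH].
  rewrite big_nil; under eq_fun do rewrite big_nil; exact: is_derive_cst.
rewrite big_cons; under eq_fun do rewrite big_cons; exact: is_deriveD.
Qed.

Lemma is_derive_half_sqr u (c du t : R) : is_derive t (1 : R) u du ->
  is_derive t (1 : R) (fun s => 2^-1 * (u s - c) ^+ 2) ((u t - c) * du).
Proof.
move=> udu; have uc : is_derive t (1 : R) (fun s => u s - c) du.
  by have := is_deriveB udu (is_derive_cst c t 1); rewrite subr0.
have := is_deriveZ (2^-1) (is_deriveM uc uc); congr (is_derive _ _ _ _).
by rewrite -[RHS]mul1r -[_ *: _]/(_ * (_ * _ + _ * _)); field.
Qed.

Lemma derive0_cst_right u : {within `[0, +oo[, continuous u} ->
  (forall t, 0 < t -> is_derive t (1 : R) u 0) -> forall t, 0 < t -> u t = u 0.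
Proof.
move=> cu du t t0; have [||x _] := @MVT R u (fun=> 0) 0 t t0.
- by move=> x; rewrite in_itv /= => /andP[x0 _]; exact: du.
- apply: continuous_subspaceW cu => x /=; rewrite !in_itv /= => /andP[-> //].
by rewrite mul0r => /eqP; rewrite subr_eq0 => /eqP.
Qed.

Lemma nonincreasing_of_derive u du : {within `[0, +oo[, continuous u} ->
  (forall t, 0 < t -> is_derive t (1 : R) u (du t)) ->
  (forall t, 0 < t -> du t <= 0) ->
  forall s t, 0 <= s -> s <= t -> u t <= u s.
Proof.
move=> cu udu du0 s t s0; rewrite le_eqVlt => /predU1P[-> //|st].
have [||x xst ust] := @MVT R u du s t st.
- move=> x; rewrite in_itv /= => /andP[sx _].
  exact/udu/(le_lt_trans s0 sx).
- apply: continuous_subspaceW cu => x /=; rewrite !in_itv /= => /andP[sx _].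
  by rewrite (le_trans s0 sx).
rewrite -subr_le0 ust mulr_le0_ge0 ?subr_ge0 ?(ltW st) // du0 //.
by move: xst; rewrite in_itv /= => /andP[sx _]; exact: le_lt_trans sx.
Qed.

Lemma cvg_fsum {T : Type} (F : set_system T) {FF : Filter F} (V : finType)
    (u : V -> T -> R) (l : V -> R) :
  (forall v, u v @ F --> l v) -> (fun x => \sum_v u v x) @ F --> \sum_v l v.
Proof.
move=> ul; elim: (index_enum V) => [|v r IH].
  rewrite big_nil; under eq_fun do rewrite big_nil; exact: cvg_cst.
by rewrite big_cons; under eq_fun do rewrite big_cons; exact: cvgD.
Qed.

Lemma cvg_sqr_dominated {T : Type} (F : set_system T) {FF : Filter F}
    (u e : T -> R) (l : R) :
  e @ F --> 0 -> F [set x | (u x - l) ^+ 2 <= e x] -> u @ F --> l.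
Proof.
move=> e0 ue; apply/cvgrPdist_le => d d0.
have d20 : 0 < d ^+ 2 by rewrite exprn_gt0.
move/cvgrPdist_le: e0 => /(_ _ d20); apply: filterS2 ue => x /= ut et.
rewrite -ler_sqr ?nnegrE ?(ltW d0) // real_normK ?num_real //.
rewrite -sqrrN opprB; apply: (le_trans ut); move: et.
by rewrite sub0r normrN; apply: le_trans; exact: ler_norm.
Qed.

End RealLine.

Section Equilibria.
Context {R : realType} {V : finType} (w : V -> V -> R) (f : V -> R -> R).
Hypotheses (Hnn : nonneg_weights w) (Hund : undirected w)
  (Hconn : connected_net w) (HC2 : forall v, C2 (f v))
  (Hconv : convex_fun (ftilde f)).
Implicit Types (y l ys ls : V -> R).

Definition equilibrium ys ls := (forall v, lap w ys v = 0) /\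
  (forall v, lap w ls v + grad_ftilde f ys v = 0).

Lemma component_tangent v (x y : R) : f v x + derive1 (f v) x * (y - x) <= f v y.
Proof.
apply: convex_tangent => [a b t|]; first exact: convex_component.
by have [] := HC2 v.
Qed.

Lemma equilibrium_saddle ys ls : equilibrium ys ls -> saddle_point w f ys ls.
Proof.
move=> [ys0 ls0] y l; rewrite /Lm.
have h0 z : inner z (lap w ys) = 0.
  by rewrite /inner big1 // => v _; rewrite ys0 mulr0.
rewrite !h0; split=> //; rewrite mulr0 !addr0.
have Q0 := inner_lap_ge0 w Hund Hnn y.
have h1 : ftilde f ys + \sum_v grad_ftilde f ys v * (y v - ys v) <= ftilde f y.
  by rewrite /ftilde -big_split; apply: ler_sum => v _; exact: component_tangent.
have h2 : \sum_v grad_ftilde f ys v * (y v - ys v) = - inner ls (lap w y).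
  have -> : inner ls (lap w y) = inner (fun v => y v - ys v) (lap w ls).
    rewrite [RHS](inner_lapC w Hund); apply: eq_bigr => v _.
    by rewrite lapB ys0 subr0.
  rewrite -sumrN; apply: eq_bigr => v _.
  have -> : grad_ftilde f ys v = - lap w ls v by have := ls0 v; lra.
  by ring.
by move: h1; rewrite h2; lra.
Qed.

Lemma minimizer_sum_derive1 (x : R) :
  (forall z, \sum_v f v x <= \sum_v f v z) -> \sum_v derive1 (f v) x = 0.
Proof.
move=> xmin.
have df z : is_derive z (1 : R) (fun s => \sum_v f v s) (\sum_v derive1 (f v) z).
  apply: is_derive_fsum => v; rewrite derive1E; apply: derivableP.
  by have [] := HC2 v.
have x1 : x \in `]x - 1, x + 1[ by rewrite in_itv /=; apply/andP; split; lra.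
have [||_ D0] := derive1_at_min _ _ x1 (fun z _ => xmin z).
- by lra.
- by move=> z _; have [] := df z.
by have [_ D] := df x; rewrite -D.
Qed.

Lemma sum_derive1_minimizer (x : R) :
  \sum_v derive1 (f v) x = 0 -> forall z, \sum_v f v x <= \sum_v f v z.
Proof.
move=> x0 z.
suff : \sum_v f v x + (\sum_v derive1 (f v) x) * (z - x) <= \sum_v f v z.
  by rewrite x0 mul0r addr0.
rewrite mulr_suml -big_split.
by apply: ler_sum => v _; exact: component_tangent.
Qed.

Lemma equilibrium_exists :
  (exists x : R, forall z : R, \sum_v f v x <= \sum_v f v z) ->
  exists x ls, equilibrium (fun=> x) ls.
Proof.
move=> [x /minimizer_sum_derive1 x0].
have [|ls lsE] := lap_solve w Hund Hnn Hconn (fun v => - derive1 (f v) x).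
  by rewrite sumrN x0 oppr0.
exists x, ls; split=> v; first exact: lap_cst.
by rewrite lsE addNr.
Qed.

Definition dissipation ys y := \sum_v (y v - ys v) *
  (grad_ftilde f y v - grad_ftilde f ys v) + inner y (lap w y).

Lemma grad_monotone ys y v :
  0 <= (y v - ys v) * (grad_ftilde f y v - grad_ftilde f ys v).
Proof. exact: convex_derive1_monotone (component_tangent v) _ _. Qed.

Lemma inner_lap_le_dissipation ys y : inner y (lap w y) <= dissipation ys y.
Proof. by rewrite lerDr sumr_ge0 // => v _; exact: grad_monotone. Qed.

Lemma dissipation_ge0 ys y : 0 <= dissipation ys y.
Proof. exact: le_trans (inner_lap_ge0 w Hund Hnn y) (inner_lap_le_dissipation ys y). Qed.

Lemma dissipation_eq0 ys y : dissipation ys y = 0 ->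
  (forall v u, y v = y u) /\ (forall v, grad_ftilde f y v = grad_ftilde f ys v).
Proof.
move=> D0; have Q0 := inner_lap_ge0 w Hund Hnn y.
have S0 : 0 <= \sum_v (y v - ys v) * (grad_ftilde f y v - grad_ftilde f ys v).
  by apply: sumr_ge0 => v _; exact: grad_monotone.
move: D0; rewrite /dissipation => D0; split.
  by apply: (inner_lap_eq0 w Hund Hnn Hconn); lra.
have /eqP : \sum_v (y v - ys v) * (grad_ftilde f y v - grad_ftilde f ys v) = 0.
  lra.
rewrite psumr_eq0 => [/allP h v|v _]; last exact: grad_monotone.
have := h v (mem_index_enum v); rewrite mulf_eq0 !subr_eq0.
by case/orP=> /eqP; rewrite /grad_ftilde // => ->.
Qed.

Definition flowY y l : V -> R :=
  fun v => - grad_ftilde f y v - lap w y v - lap w l v.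

Lemma dissipation_identity ys ls y l : equilibrium ys ls ->
  \sum_v (y v - ys v) * flowY y l v + \sum_v (l v - ls v) * lap w y v =
  - dissipation ys y.
Proof.
move=> [ys0 ls0]; rewrite /dissipation.
have E1 : \sum_v ((l v - ls v) * (lap w y v - lap w ys v) -
    (y v - ys v) * (lap w l v - lap w ls v)) = 0.
  apply/eqP; rewrite sumrB subr_eq0; apply/eqP.
  have := inner_lapC w Hund (fun v => l v - ls v) (fun v => y v - ys v).
  by rewrite /inner; under eq_bigr do rewrite lapB;
     under [X in _ = X -> _]eq_bigr do rewrite lapB.
have E2 : inner ys (lap w y) = 0.
  by rewrite (inner_lapC w Hund) /inner big1 // => v _; rewrite ys0 mulr0.
apply/eqP; rewrite -subr_eq0 opprK; apply/eqP.
rewrite -[RHS](addr0 0) -[X in _ = X + _]E1 -[X in _ = _ + X]E2.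
rewrite /inner -!big_split; apply: eq_bigr => v _ /=.
have -> : grad_ftilde f ys v = - lap w ls v by have := ls0 v; lra.
by rewrite ys0 /flowY; ring.
Qed.

End Equilibria.

Section LaplacianLimits.
Context {R : realType} {V : finType} (w : V -> V -> R).

Lemma cvg_lap {T : Type} (F : set_system T) {FF : Filter F}
    (y : T -> V -> R) (l : V -> R) : (forall v, (fun x => y x v) @ F --> l v) ->
  forall v, (fun x => lap w (y x) v) @ F --> lap w l v.
Proof.
by move=> yl v; apply: cvg_fsum => u; apply: cvgM; [exact: cvg_cst|exact: yl].
Qed.

Lemma is_derive_lap (y : R -> V -> R) (dy : V -> R) (t : R) :
  (forall v, is_derive t (1 : R) (fun s => y s v) (dy v)) ->
  forall v, is_derive t (1 : R) (fun s => lap w (y s) v) (lap w dy v).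
Proof.
by move=> ydy v; apply: is_derive_fsum => u; exact: is_deriveZ.
Qed.

Lemma bounded_pos_lap (y : R -> V -> R) :
  (forall v, bounded_pos (fun t => y t v)) ->
  forall v, bounded_pos (fun t => lap w (y t) v).
Proof.
by move=> yB v; apply: bounded_pos_sum => u; apply: bounded_posZ.
Qed.

Lemma bounded_lipschitz_lap (y : R -> V -> R) :
  (forall v, bounded_lipschitz (fun t => y t v)) ->
  forall v, bounded_lipschitz (fun t => lap w (y t) v).
Proof.
move=> yB v; apply: bounded_lipschitz_sum => u; apply: bounded_lipschitzM => //.
exact: bounded_lipschitz_cst.
Qed.

Lemma cvg_lap_of_inner_lap {T : Type} (F : set_system T) {FF : Filter F}
    (y : T -> V -> R) (Hund : undirected w) (Hnn : nonneg_weights w) :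
  (fun x => inner (y x) (lap w (y x))) @ F --> 0 ->
  forall v, (fun x => lap w (y x) v) @ F --> 0.
Proof.
move=> q0 v; suff : (fun x => \sum_u w v u * (y x v - y x u)) @ F --> \sum_(u : V) (0 : R).
  by under eq_fun do rewrite -(lapE w Hund); rewrite big1.
apply: cvg_fsum => u.
have e0 : (fun x => w v u * 2 * inner (y x) (lap w (y x))) @ F --> 0.
  by rewrite -(mulr0 (w v u * 2)); apply: cvgM => //; exact: cvg_cst.
apply: (cvg_sqr_dominated _ _ _ _ e0); apply: nearW => x.
rewrite /= subr0 exprMn expr2 -!mulrA ler_wpM2l //.
exact: edge_le_inner_lap.
Qed.

End LaplacianLimits.

Section Trajectory.
Context {R : realType} {V : finType} (w : V -> V -> R) (f : V -> R -> R).
Hypotheses (Hnn : nonneg_weights w) (Hund : undirected w)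
  (Hconn : connected_net w) (HC2 : forall v, C2 (f v))
  (Hconv : convex_fun (ftilde f)).
Variables Y Lam : R -> V -> R.
Hypotheses (HYc : forall v, {within `[0, +oo[, continuous (fun t => Y t v)})
  (HLc : forall v, {within `[0, +oo[, continuous (fun t => Lam t v)})
  (HYd : forall t : R, 0 < t -> forall v,
      is_derive t (1 : R) (fun s : R => Y s v) (flowY w f (Y t) (Lam t) v))
  (HLd : forall t : R, 0 < t -> forall v,
      is_derive t (1 : R) (fun s : R => Lam s v) (lap w (Y t) v)).
Implicit Types (ys ls : V -> R) (t : R).

Definition energy ys ls (t : R) :=
  \sum_v 2^-1 * (Y t v - ys v) ^+ 2 + \sum_v 2^-1 * (Lam t v - ls v) ^+ 2.

Lemma sqr_Y_le_energy ys ls t v : (Y t v - ys v) ^+ 2 <= 2 * energy ys ls t.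
Proof.
rewrite /energy (bigD1 v) //= mulrDr mulrDr mulVKf ?pnatr_eq0 // -addrA lerDl.
by rewrite addr_ge0 // mulr_ge0 // sumr_ge0 // => u _; rewrite mulr_ge0 ?invr_ge0 ?sqr_ge0.
Qed.

Lemma sqr_Lam_le_energy ys ls t v : (Lam t v - ls v) ^+ 2 <= 2 * energy ys ls t.
Proof.
rewrite [energy _ _ _]addrC (bigD1 v) //= mulrDr mulrDr mulVKf ?pnatr_eq0 // -addrA lerDl.
by rewrite addr_ge0 // mulr_ge0 // sumr_ge0 // => u _; rewrite mulr_ge0 ?invr_ge0 ?sqr_ge0.
Qed.

Lemma energy_ge0 ys ls t : 0 <= energy ys ls t.
Proof.
by rewrite addr_ge0 // sumr_ge0 // => u _; rewrite mulr_ge0 ?invr_ge0 ?sqr_ge0.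
Qed.

Lemma cvg_energy (F : set_system R) {FF : Filter F} ys ls y l :
  (forall v, (fun t => Y t v) @ F --> y v) ->
  (forall v, (fun t => Lam t v) @ F --> l v) ->
  energy ys ls @ F --> \sum_v 2^-1 * (y v - ys v) ^+ 2 +
                       \sum_v 2^-1 * (l v - ls v) ^+ 2.
Proof.
move=> Yy Ll; apply: cvgD; apply: cvg_fsum => v; rewrite expr2;
  under eq_fun do rewrite expr2; apply: cvgM; try exact: cvg_cst;
  by apply: cvgM; apply: cvgB => //; exact: cvg_cst.
Qed.

Lemma continuous_energy ys ls : {within `[0, +oo[, continuous (energy ys ls)}.
Proof.
move=> x; pose A := subspace `[0 : R, +oo[.
by apply: (@cvg_energy (nbhs (x : A)) _ ys ls (Y x) (Lam x)) => v;
  [exact: HYc | exact: HLc].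
Qed.

Lemma is_derive_energy ys ls t : equilibrium w f ys ls -> 0 < t ->
  is_derive t (1 : R) (energy ys ls) (- dissipation w f ys (Y t)).
Proof.
move=> eq_ys t0; rewrite -(dissipation_identity w f Hund _ _ _ (Lam t) eq_ys).
apply: is_deriveD; apply: is_derive_fsum => v; apply: is_derive_half_sqr.
  exact: HYd.
exact: HLd.
Qed.

Lemma energy_nonincreasing ys ls : equilibrium w f ys ls ->
  forall s t, 0 <= s -> s <= t -> energy ys ls t <= energy ys ls s.
Proof.
move=> eq_ys; apply: (nonincreasing_of_derive _
  (fun t => - dissipation w f ys (Y t))); first exact: continuous_energy.
- by move=> t; exact: is_derive_energy.
- by move=> t _; rewrite oppr_le0; exact: dissipation_ge0.
Qed.

Section Boundedness.
Variables ys ls : V -> R.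
Hypothesis eq_ys : equilibrium w f ys ls.

Lemma bounded_of_sqr (u : R -> R) (c E : R) :
  (forall t, 0 < t -> (u t - c) ^+ 2 <= E) -> bounded_pos u.
Proof.
move=> uE; exists (`|c| + E + 1) => t /uE ut.
have := ler_normD (u t - c) c; rewrite subrK => h.
have h1 : `|u t - c| <= `|u t - c| ^+ 2 + 1.
  have := sqr_ge0 (`|u t - c| - 1); rewrite sqrrB1.
  have := normr_ge0 (u t - c); have := sqr_ge0 `|u t - c|; lra.
move: h1; rewrite real_normK ?num_real //; lra.
Qed.

Lemma bounded_Y v : bounded_pos (fun t => Y t v).
Proof.
apply: (bounded_of_sqr _ (ys v) (2 * energy ys ls 0)) => t t0.
apply: le_trans (sqr_Y_le_energy ys ls t v) _.
by rewrite ler_pM2l // energy_nonincreasing // ltW.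
Qed.

Lemma bounded_Lam v : bounded_pos (fun t => Lam t v).
Proof.
apply: (bounded_of_sqr _ (ls v) (2 * energy ys ls 0)) => t t0.
apply: le_trans (sqr_Lam_le_energy ys ls t v) _.
by rewrite ler_pM2l // energy_nonincreasing // ltW.
Qed.

Lemma continuous_grad v : continuous (derive1 (f v)).
Proof.
move=> x; apply/differentiable_continuous/derivable1_diffP.
by have [_ [df _]] := HC2 v.
Qed.

Lemma bounded_lipschitz_Y v : bounded_lipschitz (fun t => Y t v).
Proof.
apply: (bounded_lipschitz_derive _ (fun t => flowY w f (Y t) (Lam t) v)).
- exact: bounded_Y.
- rewrite /flowY; apply: bounded_posD; first apply: bounded_posD.
  + apply: bounded_posN; apply: bounded_pos_comp (bounded_Y v).
    exact: continuous_grad.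
  + by apply: bounded_posN; apply: bounded_pos_lap => u; exact: bounded_Y.
  + by apply: bounded_posN; apply: bounded_pos_lap => u; exact: bounded_Lam.
- by move=> t t0; exact: HYd.
Qed.

Lemma bounded_lipschitz_Lam v : bounded_lipschitz (fun t => Lam t v).
Proof.
apply: (bounded_lipschitz_derive _ (fun t => lap w (Y t) v)).
- exact: bounded_Lam.
- by apply: bounded_pos_lap => u; exact: bounded_Y.
- by move=> t t0; exact: HLd.
Qed.

Lemma bounded_lipschitz_grad v :
  bounded_lipschitz (fun t => grad_ftilde f (Y t) v).
Proof.
have [_ [df cdf]] := HC2 v.
exact: (bounded_lipschitz_comp (derive1 (f v)) _ df cdf (bounded_lipschitz_Y v)).
Qed.

Lemma bounded_lipschitz_flowY v :
  bounded_lipschitz (fun t => flowY w f (Y t) (Lam t) v).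
Proof.
rewrite /flowY; apply: bounded_lipschitzD; first apply: bounded_lipschitzD.
- exact/bounded_lipschitzN/bounded_lipschitz_grad.
- by apply/bounded_lipschitzN/bounded_lipschitz_lap => u; exact: bounded_lipschitz_Y.
- by apply/bounded_lipschitzN/bounded_lipschitz_lap => u; exact: bounded_lipschitz_Lam.
Qed.

Lemma cvg_dissipation : (fun t => dissipation w f ys (Y t)) @ +oo --> 0.
Proof.
have [l El] : exists l : R, energy ys ls @ +oo --> l.
  apply: nonincreasing_cvg_pinfty; last exact: energy_ge0.
  by move=> s t s0; apply: energy_nonincreasing => //; exact: ltW.
have [K _ [_ KD]] : bounded_lipschitz (fun t => - dissipation w f ys (Y t)).
  apply/bounded_lipschitzN/bounded_lipschitzD; apply: bounded_lipschitz_sum => v.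
    apply: bounded_lipschitzM; apply: bounded_lipschitzD;
      try exact: bounded_lipschitz_cst.
      exact: bounded_lipschitz_Y.
    exact: bounded_lipschitz_grad.
  apply: bounded_lipschitzM; first exact: bounded_lipschitz_Y.
  by apply: bounded_lipschitz_lap => u; exact: bounded_lipschitz_Y.
have := barbalat _ _ _ _ (fun t => is_derive_energy ys ls t eq_ys) KD El.
move=> /cvgN; rewrite oppr0; apply: cvg_trans; apply: near_eq_cvg.
by apply: nearW => t; rewrite fctE opprK.
Qed.

Lemma cvg_lapY v : (fun t => lap w (Y t) v) @ +oo --> 0.
Proof.
apply: cvg_lap_of_inner_lap => //.
apply: (@squeeze_cvgr _ _ _ _ (fun=> 0) (fun t => dissipation w f ys (Y t))).
- apply: nearW => t; rewrite (inner_lap_ge0 w Hund Hnn) /=.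
  exact: inner_lap_le_dissipation.
- exact: cvg_cst.
- exact: cvg_dissipation.
Qed.

Lemma cvg_lap_flowY v : (fun t => lap w (flowY w f (Y t) (Lam t)) v) @ +oo --> 0.
Proof.
have [K _ [_ KD]] := bounded_lipschitz_lap w _ bounded_lipschitz_flowY v.
apply: barbalat KD (cvg_lapY v) => t t0.
by apply: is_derive_lap => u; exact: HYd.
Qed.

Lemma cluster_equilibrium (G : set_system R) {FG : ProperFilter G}
    (y l : V -> R) :
  nbhs +oo `<=` G ->
  (forall v, (fun t => Y t v) @ G --> y v) ->
  (forall v, (fun t => Lam t v) @ G --> l v) ->
  equilibrium w f y l /\ (forall v u, y v = y u).
Proof.
move=> oG Yy Ll.
have toG (u : R -> R) (a : R) : u @ +oo --> a -> u @ G --> a.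
  by move=> ua A /ua; exact: oG.
have gradG v : (fun t => grad_ftilde f (Y t) v) @ G --> grad_ftilde f y v.
  by apply: continuous_cvg => //; exact: continuous_grad.
have lapG := cvg_lap w G _ _ Yy.
have D0 : dissipation w f ys y = 0.
  apply: (cvg_unique _ _ (toG _ _ cvg_dissipation)) => //.
  apply: cvgD; apply: cvg_fsum => v; last by apply: cvgM; [exact: Yy|exact: lapG].
  by apply: cvgM; apply: cvgB; try exact: cvg_cst; [exact: Yy | exact: gradG].
have [y_cst gradE] := dissipation_eq0 w f Hnn Hund Hconn HC2 Hconv _ _ D0.
have lapy v : lap w y v = 0.
  have -> : y = fun=> y v by apply/funext => u; exact: y_cst.
  exact: lap_cst.
pose z := flowY w f y l.
have zG v : (fun t => flowY w f (Y t) (Lam t) v) @ G --> z v.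
  apply: cvgB; last exact: cvg_lap.
  by apply: cvgB; [exact: (cvgN (gradG v)) | exact: lapG].
have lapz v : lap w z v = 0.
  apply: (cvg_unique _ _ (toG _ _ (cvg_lap_flowY v))) => //.
  exact: (cvg_lap w G _ _ zG).
have z_cst : forall v u, z v = z u.
  apply: (inner_lap_eq0 w Hund Hnn Hconn).
  by rewrite /inner big1 // => v _; rewrite lapz mulr0.
have sum_grad : \sum_v grad_ftilde f y v = 0.
  rewrite (eq_bigr (fun v => - lap w ls v)) => [|v _].
    by rewrite sumrN sum_lap // oppr0.
  by rewrite gradE; have := eq_ys.2 v; lra.
have sum_z : \sum_v z v = 0.
  rewrite /z /flowY !sumrB sumrN sum_grad !sum_lap //; lra.
split=> //; split=> // v.
have z0 : z v = 0.
  move: sum_z; rewrite (eq_bigr (fun=> z v)) => [|u _]; last exact: z_cst.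
  rewrite sumr_const => /eqP; rewrite mulrn_eq0 => /orP[/eqP n0|/eqP //].
  by have := fintype0 v n0.
by move: z0; rewrite /z /flowY lapy; lra.
Qed.

End Boundedness.

Lemma trajectory_converges :
  (exists x : R, forall z : R, \sum_v f v x <= \sum_v f v z) ->
  exists y l, [/\ forall v, (fun t => Y t v) @ +oo --> y v,
    forall v, (fun t => Lam t v) @ +oo --> l v,
    equilibrium w f y l & forall v u, y v = y u].
Proof.
move=> /(equilibrium_exists w f Hnn Hund Hconn HC2)[x [ls eq_x]].
have [G [GU oG]] := ultraFilterLemma (@proper_pinfty_nbhs R).
have limG (u : R -> R) : bounded_pos u -> exists l : R, u @ G --> l.
  move=> [K uK]; apply: (ultra_bounded_cvg G GU u K); apply: oG.
  by exists 0; split => // t; exact: uK.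
have [y Yy] := choice (fun v => limG _ (bounded_Y _ _ eq_x v)).
have [l Ll] := choice (fun v => limG _ (bounded_Lam _ _ eq_x v)).
have [eq_y y_cst] := cluster_equilibrium _ _ eq_x G y l oG Yy Ll.
have EG : energy y l @ G --> 0.
  have s0 (a : V -> R) : \sum_v 2^-1 * (a v - a v) ^+ 2 = 0.
    by rewrite big1 // => v _; rewrite subrr expr0n mulr0.
  have := cvg_energy G y l y l Yy Ll; rewrite !s0 addr0; exact.
have E0 : (fun t => 2 * energy y l t) @ +oo --> 0.
  rewrite -(mulr0 2); apply: cvgM; first exact: cvg_cst.
  apply/cvgrPdist_le => /= e e0.
  have : G (fun t => 0 < t /\ energy y l t <= e).
    apply: filterI; first by apply: oG; exists 0; split.
    move/cvgrPdist_le: EG => /(_ _ e0); apply: filterS => t.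
    by rewrite sub0r normrN ger0_norm // energy_ge0.
  move=> /filter_ex[s [s0 sE]]; exists s; split; first exact: num_real.
  move=> t st; rewrite sub0r normrN ger0_norm ?energy_ge0 //.
  by apply: le_trans sE; apply: energy_nonincreasing => //; exact: ltW.
exists y, l; split=> // v; apply: (cvg_sqr_dominated _ _ _ _ E0);
  apply: filterE => t; [exact: sqr_Y_le_energy | exact: sqr_Lam_le_energy].
Qed.

Lemma sum_Lam_conserved t : 0 < t -> \sum_v Lam t v = \sum_v Lam 0 v.
Proof.
apply: (derive0_cst_right (fun t => \sum_v Lam t v)).
  by move=> x; apply: cvg_fsum => v; exact: HLc.
by move=> s s0; have := is_derive_fsum _ _ _ s (HLd s s0); rewrite sum_lap.
Qed.

End Trajectory.

Theorem theorem2 (R : realType) (M : nat) (N : 'I_M -> nat)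
  (w : node N -> node N -> R) (f : node N -> R -> R)
  (Hnn : nonneg_weights w) (Hund : undirected w) (Hconn : connected_net w)
  (HC2 : forall v, C2 (f v)) (Hconv : convex_fun (ftilde f))
  (Hopt : exists x : R, forall z : R,
      \sum_(v : node N) f v x <= \sum_(v : node N) f v z)
  (Y Lam : R -> node N -> R)
  (HYc : forall v, {within `[0, +oo[, continuous (fun t => Y t v)})
  (HLc : forall v, {within `[0, +oo[, continuous (fun t => Lam t v)})
  (HYd : forall t : R, 0 < t -> forall v : node N,
      is_derive t (1 : R) (fun s : R => Y s v)
        (- grad_ftilde f (Y t) v - lap w (Y t) v - lap w (Lam t) v))
  (HLd : forall t : R, 0 < t -> forall v : node N,
      is_derive t (1 : R) (fun s : R => Lam s v) (lap w (Y t) v)) :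
  exists (Ys Ls : node N -> R),
    (forall v, (fun t => Y t v) @ +oo --> Ys v) /\
    (forall v, (fun t => Lam t v) @ +oo --> Ls v) /\
    saddle_point w f Ys Ls /\
    (exists xs : R,
        (forall z : R, \sum_(v : node N) f v xs <= \sum_(v : node N) f v z) /\
        Ys = (fun v => xs * @ones R (node N) v)) /\
    (exists Lbar : node N -> R,
        inner Lbar (@ones R (node N)) = 0 /\
        (forall v, lap w Lbar v + grad_ftilde f Ys v = 0) /\
        Ls = (fun v => Lbar v + average (Lam 0) * @ones R (node N) v)).
Proof.
have [Ys [Ls [YsE LsE eqs Ys_cst]]] := trajectory_converges
  w f Hnn Hund Hconn HC2 Hconv Y Lam HYc HLc HYd HLd Hopt.
exists Ys, Ls; do 3 split=> //; first exact: equilibrium_saddle.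
have [eqY eqL] := eqs; split.
  exists (if [pick v] is Some v then Ys v else 0).
  set xs := (X in _ /\ _ = (fun v => X * _)).
  have xsE v : Ys v = xs by rewrite /xs; case: pickP => [u _|/(_ v)].
  split; last by apply/funext => v; rewrite mulr1 xsE.
  apply: sum_derive1_minimizer => //.
  have : \sum_v (lap w Ls v + grad_ftilde f Ys v) = 0 by rewrite big1.
  rewrite big_split /= sum_lap // add0r; apply: etrans.
  by apply: eq_bigr => v _; rewrite /grad_ftilde xsE.
have sumL : \sum_v Ls v = \sum_v Lam 0 v.
  have sumLs : (fun t => \sum_v Lam t v) @ +oo --> \sum_v Ls v.
    exact: cvg_fsum.
  apply: (cvg_unique _ sumLs) => //.
  apply: cvg_near_cst; exists 0; split=> // t t0.
  exact: (sum_Lam_conserved w Hund Y Lam HLc HLd).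
exists (fun v => Ls v - average (Lam 0)); split; last split=> [v|].
- rewrite /inner; under eq_bigr do rewrite mulr1.
  rewrite sumrB sumL sumr_const -mulr_natl /average.
  have [n0|n0] := eqVneq #|node N| 0%N.
    by rewrite !big1 ?n0 ?mul0r ?subrr // => v _; have := fintype0 v n0.
  by rewrite mulVKf ?pnatr_eq0 // subrr.
- by rewrite lapB lap_cst // subr0 eqL.
- by apply/funext => v; rewrite mulr1 subrK.
Qed.
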